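(* Let $N$ be an even positive integer, let $T>0$, and let $t\mapsto H(t)$ ($t\in\mathbb{R}$) be a continuous, $T$-periodic family of Hermitian $N\times N$ complex matrices. Let $\Gamma\in\mathbb{C}^{N\times N}$ be a unitary matrix with $\Gamma^2=I$ whose eigenspaces for $-1$ and for $+1$ have the same dimension $N/2$. Suppose that $\Gamma H(t)\Gamma=-H(-t)$ for all $t$. Let $U(T)$ be the Floquet operator (the time evolution operator over one period) of $H(t)$. Then there is a Hermitian matrix $H\in\mathbb{C}^{N\times N}$ with $$\Gamma H=-H\Gamma\quad\text{and}\quad e^{-iH}=U(T).$$ Moreover, there are an orthonormal basis $\boldsymbol{b}_1,\dots,\boldsymbol{b}_N$ of $\mathbb{C}^N$ and complex scalars $\lambda_1,\dots,\lambda_N$ of modulus one such that $U(T)\boldsymbol{b}_j=\lambda_j\boldsymbol{b}_j$ for $j=1,\dots,N$, and $$\Gamma\boldsymbol{b}_j=\boldsymbol{b}_{\frac N2+j},\qquad \overline{\lambda_j}=\lambda_{\frac N2+j}\qquad\text{for } j=1,\dots,N/2.$$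
   Context: The Floquet operator $U(T)=U(0,T)$ is the time evolution operator from time $0$ to time $T$ generated by $H(t)$, i.e. the value at $t=T$ of the solution of $\frac{d}{dt}U(t)=-iH(t)U(t)$, $U(0)=I$. Equivalently, $$U(T)=\lim_{M\to\infty}e^{-i(T/M)H(T)}\cdots e^{-i(T/M)H(2T/M)}e^{-i(T/M)H(T/M)}.$$ It is a unitary matrix. *)

(* Defs.v *)
From mathcomp Require Export all_boot all_order all_algebra.
From mathcomp Require Export complex.
From mathcomp Require Export all_classical all_reals all_analysis.

Set Implicit Arguments.
Unset Strict Implicit.
Unset Printing Implicit Defensive.

Export Order.TTheory GRing.Theory Num.Theory.
Export numFieldNormedType.Exports.

Local Open Scope classical_set_scope.
Local Open Scope ring_scope.

(* The topology and the norm on matrices are inherited from the canonical ones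
   of a numClosedFieldType, and they are not found on the bare record R[i]. *)
Definition Cplx (R : realType) : numClosedFieldType := R[i].

Definition expmx (C : numClosedFieldType) (n : nat) (A : 'M[C]_n) : 'M[C]_n :=
  limn (series (fun k : nat => (k`!%:R)^-1 *: A ^+ k)).

(* Matrices over C form a normed module over C but not over R, so derivatives
   in a real variable are limits of difference quotients with h embedded in C. *)
Definition has_mxderiv (R : realType) (m n : nat)
    (U : R -> 'M[Cplx R]_(m, n)) (t : R) (D : 'M[Cplx R]_(m, n)) : Prop :=
  (real_complex R h : Cplx R)^-1 *: (U (t + h) - U t) @[h --> 0^'] --> D.

(* d/dt U(t) = -i H(t) U(t), U(0) = I. *)
Definition evolution (R : realType) (n : nat) (H U : R -> 'M[Cplx R]_n) : Prop :=
  U 0 = 1%:M /\ forall t, has_mxderiv U t (- 'i *: (H t *m U t)).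

(* The initial value problem defining the evolution operator has exactly one
   solution when H is continuous, so V is determined by H and T. *)
Definition is_floquet (R : realType) (n : nat) (H : R -> 'M[Cplx R]_n) (T : R)
    (V : 'M[Cplx R]_n) : Prop :=
  exists2 U : R -> 'M[Cplx R]_n, evolution H U & U T = V.

(* dotmx is the Hermitian product of row vectors, hence the transpositions. *)
Definition orthonormal_basis (C : numClosedFieldType) (n : nat)
    (b : 'I_n -> 'cV[C]_n) : Prop :=
  basis_of fullv (codom b) /\
  forall i j, dotmx (b i)^T (b j)^T = (i == j)%:R.

(* eigenspace acts on row vectors, so the eigenvectors v with A *m v = a *: v
   are the transposed rows of eigenspace A^T a. *)
Definition dim_eigenspace (C : numClosedFieldType) (n : nat) (A : 'M[C]_n)
    (a : C) : nat :=
  \rank (eigenspace A^T a).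

(* Main.v *)
From mathcomp Require Import ring.
From mathcomp Require Import perm.
Require Import Defs.

Set Implicit Arguments.
Unset Strict Implicit.
Unset Printing Implicit Defensive.

Import complex.
Local Open Scope ring_scope.

(** Two solutions U and V of the equation X' = -i H X with H Hermitian have a
    constant product U^* V, because the two terms of its derivative cancel.
    This single conservation law makes the evolution operator unitary and
    determines every solution from its value at 0.  Applied to the solutions
    t |-> U (t + T) and t |-> Gamma U (-t) Gamma, it gives
    U (t + T) = U t * U T and U (-t) = Gamma * U t * Gamma, and the value
    t = - T / 2 then yields
      U T = Gamma G Gamma G^*   with   G = U (T / 2)^*.
    So U T is not an arbitrary unitary matrix with Gamma (U T) Gamma = (U T)^*:
    it is the product of Gamma and of a unitary conjugate of Gamma.  This is
    what matters at the eigenvalues 1 and -1.  Their eigenspaces are stable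
    under Gamma, and the basis can exist only if Gamma has signature 0 on each
    of them.  The symmetry alone does not give this: U = Gamma has it.

    In coordinates where Gamma = diag (1, -1), put U T = (A, B; - B^*, D) and
    G = (a, b; c, d).  Then A = 2 a a^* - 1 and D = 2 d d^* - 1.  For a square
    matrix M, the matrices M M^* and M^* M are unitarily similar
    ([gram_similar]), and the unitarity of G links a^* a to c^* c and c c^* to
    d d^*; hence A and D are unitarily similar.  After a change of basis in
    each of the two eigenspaces of Gamma, both are a real diagonal matrix k,
    and B commutes with k and satisfies B B^* = B^* B = 1 - k^2.  A polar
    decomposition B = R s with s = sqrt (1 - k^2) ([commuting_polar]) shows
    that the columns of L = (- i R; 1) / sqrt 2 are orthonormal eigenvectors
    for k + i s ([paired_eigenvectors], [eigenframe_block]), and L and Gamma L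
    have orthogonal ranges.  The columns of L, followed by those of Gamma L,
    are the basis ([eigenframe]).

    The effective Hamiltonian has the same eigenvectors.  Choose t_j with
    exp (- i t_j) = lambda_j on the columns of L and take - t_j on those of
    Gamma L: exchanging L with Gamma L changes the sign of the matrix
    ([paired_generator]).  Its exponential is computed eigenvalue by
    eigenvalue from the power series of cos and sin. *)

(** * Unitary similarity *)

(** Both determinants are read off the block matrix (X, A; B, 1), reduced to
    triangular form in two ways; the second one costs a factor X^n, which
    cancels in the polynomial ring. *)
Lemma char_poly_mulmxC (F : idomainType) n (A B : 'M[F]_n) :
  char_poly (A *m B) = char_poly (B *m A).
Proof.
pose a := map_mx polyC A; pose b := map_mx polyC B.
pose M := block_mx ('X%:M) a b 1%:M.
have E1 : block_mx 1%:M (- a) 0 1%:M *m M = block_mx ('X%:M - a *m b) 0 b 1%:M.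
  rewrite mulmx_block !mul1mx mulNmx !mulmx1 !mul0mx !add0r.
  by rewrite addrN.
have E2 : block_mx 1%:M 0 (- b) ('X%:M) *m M
    = block_mx ('X%:M) a 0 ('X%:M - b *m a).
  rewrite mulmx_block !mul1mx !mul0mx mulmx1 !addr0 !mulNmx.
  by rewrite mul_scalar_mx mul_mx_scalar addNr addrC.
have := congr1 determinant E1; rewrite det_mulmx det_ublock det_lblock !det1.
rewrite !mul1r mulr1 => E1'.
have := congr1 determinant E2.
rewrite det_mulmx det_ublock det_lblock det1 mul1r E1' !det_scalar.
rewrite /char_poly /char_poly_mx !map_mxM => /mulfI; apply.
by rewrite expf_neq0 // polyX_eq0.
Qed.

Section Unitary.
Variable C : numClosedFieldType.
Local Open Scope sesquilinear_scope.

Lemma trmxC_mul m n p (A : 'M[C]_(m, n)) (B : 'M[C]_(n, p)) :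
  (A *m B)^t* = B^t* *m A^t*.
Proof. by rewrite trmx_mul map_mxM. Qed.

Lemma trmxC_mul_unitary n (W : 'M[C]_n) : W \is unitarymx -> W^t* *m W = 1%:M.
Proof. by move=> /unitarymxP/mulmx1C. Qed.

Lemma unitary_perm_mx n (s : 'S_n) : perm_mx s \is @unitarymx C n n.
Proof.
by apply/unitarymxP; rewrite tr_perm_mx map_perm_mx -perm_mxM mulgV perm_mx1.
Qed.

(** Normal matrices are unitarily diagonalisable, and the characteristic
    polynomial lists the diagonal up to a permutation. *)
Lemma normal_char_poly_similar n (A B : 'M[C]_n) :
  A \is normalmx -> B \is normalmx -> char_poly A = char_poly B ->
  exists2 W, W \is unitarymx & A = W *m B *m W^t*.
Proof.
move=> /orthomx_spectralP; move: (spectralmx A) (spectral_diag A)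
  (spectral_unitarymx A) => P a uP.
rewrite invmx_unitary // => ->.
move=> /orthomx_spectralP; move: (spectralmx B) (spectral_diag B)
  (spectral_unitarymx B) => Q b uQ.
rewrite invmx_unitary // => ->.
have cp (X : 'M[C]_n) (d : 'rV_n) : X \is unitarymx ->
    char_poly (X^t* *m diag_mx d *m X)
    = \prod_(x <- [seq d 0 i | i <- enum 'I_n]) ('X - x%:P).
  move=> uX; rewrite char_poly_mulmxC mulmxA (unitarymxP uX) mul1mx.
  rewrite char_poly_trig ?diag_mx_is_trig // big_map big_enum /=.
  by apply: eq_bigr => i _; rewrite !mxE eqxx.
rewrite !cp // => /prod_XsubC_eq.
rewrite perm_sym => eab.
have /tuple_permP[s /val_inj{}eab] :
  perm_eq [tuple b 0 i | i < n] [tuple a 0 i | i < n] by [].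
have {}eab i : b 0 i = a 0 (s i).
  by have /(congr1 (fun t => tnth t i)) := eab; rewrite !tnth_mktuple.
have bE : diag_mx b = perm_mx s *m diag_mx a *m (perm_mx s)^t*.
  rewrite tr_perm_mx map_perm_mx -col_permE -row_permE.
  apply/matrixP => i j; rewrite !mxE eab.
  by rewrite (inj_eq perm_inj).
exists (P^t* *m (perm_mx s)^t* *m Q).
  by rewrite !mul_unitarymx ?trmxC_unitary ?unitary_perm_mx.
rewrite bE !trmxC_mul !trmxCK !mulmxA.
do 2 rewrite (mulmxtVK _ uQ).
by rewrite !(mulmxKtV _ (unitary_perm_mx s)).
Qed.

(** For a square matrix, the two Gram matrices are Hermitian with the same
    characteristic polynomial. *)
Lemma gram_similar n (M : 'M[C]_n) :
  exists2 W, W \is unitarymx & M *m M^t* = W *m (M^t* *m M) *m W^t*.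
Proof.
apply: normal_char_poly_similar; last exact: char_poly_mulmxC.
  by apply/normalmxP; rewrite trmxC_mul trmxCK.
by apply/normalmxP; rewrite trmxC_mul trmxCK.
Qed.

(** * Eigenvectors paired by an involution *)

Lemma gram_eq0 m n (M : 'M[C]_(m, n)) : M^t* *m M = 0 -> M = 0.
Proof.
move=> M0; apply/matrixP => i j; rewrite [RHS]mxE.
have := congr1 (fun A : 'M[C]_n => A j j) M0; rewrite !mxE.
under eq_bigr => k _ do rewrite !mxE mulrC -normCK.
move=> /psumr_eq0P/(_ i isT) /= e0; apply/eqP; rewrite -normr_eq0 -sqrf_eq0.
by rewrite e0 // => k _; rewrite exprn_ge0.
Qed.

(** An intertwiner of two diagonal matrices is supported where their entries
    agree, and this support does not see which function is applied to them. *)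
Lemma mulmx_diag_fun m (f : C -> C) (c d : 'rV[C]_m) (B : 'M[C]_m) :
  diag_mx c *m B = B *m diag_mx d ->
  diag_mx (map_mx f c) *m B = B *m diag_mx (map_mx f d).
Proof.
move=> /matrixP cB; apply/matrixP => i j; have := cB i j.
rewrite !mul_diag_mx !mul_mx_diag !mxE => cBij.
have [->|B0] := eqVneq (B i j) 0; first by rewrite mulr0 mul0r.
by move: cBij; rewrite mulrC => /(mulfI B0) ->; rewrite mulrC.
Qed.

(** The entries with [f x = 0] belong to columns where [B] vanishes, so the
    identity can be used there to complete [B s^-1] to a unitary matrix. *)
Lemma commuting_polar n (B : 'M[C]_n) (c : 'rV[C]_n) (f : C -> C)
    (s := map_mx f c) (s2 := map_mx (fun x => f x ^+ 2) c) :
  (forall x, f x \is Num.real) ->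
  B *m B^t* = diag_mx s2 -> B^t* *m B = diag_mx s2 ->
  diag_mx c *m B = B *m diag_mx c ->
  exists R : 'M[C]_n, [/\ R \is unitarymx, R *m diag_mx s = B
     & diag_mx c *m R = R *m diag_mx c].
Proof.
move=> fR BB B'B cB.
(* As 0^-1 = 0, E is the pseudo-inverse of s, and P projects on its kernel. *)
pose E := diag_mx (map_mx (fun x => (f x)^-1) c).
pose P := diag_mx (map_mx (fun x => (f x == 0)%:R) c) : 'M[C]_n.
have dM g h : diag_mx (map_mx g c) *m diag_mx (map_mx h c)
    = diag_mx (map_mx (fun x => g x * h x) c).
  by rewrite mulmx_diag; congr diag_mx; apply/rowP => j; rewrite !mxE.
have dR g : (forall x, g x \is Num.real) ->
    (diag_mx (map_mx g c))^t* = diag_mx (map_mx g c).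
  move=> gR; rewrite tr_diag_mx map_diag_mx; congr diag_mx.
  by apply/rowP => j; rewrite !mxE; apply/CrealP.
have E' : E^t* = E by apply: dR => x; rewrite realV.
have P' : P^t* = P by apply: dR => x; rewrite realn.
have EP : E *m P = 0.
  rewrite /E /P dM -[RHS](linear0 (@diag_mx C n)); congr diag_mx.
  apply/rowP => j; rewrite !mxE.
  by case: eqVneq => [->|_]; rewrite ?invr0 (mul0r, mulr0).
have PE : P *m E = 0 by rewrite diag_mxC.
have BP : B *m P = 0.
  apply: gram_eq0; rewrite trmxC_mul P' mulmxA -(mulmxA P) B'B.
  rewrite /s2 /P !dM -[RHS](linear0 (@diag_mx C n)); congr diag_mx.
  apply/rowP => j; rewrite !mxE.
  by case: eqVneq => [->|_]; rewrite ?expr0n ?mulr0 ?mul0r ?mulr0.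
have EB : E *m B = B *m E by exact: mulmx_diag_fun.
have PP : P *m P = P.
  rewrite /P dM; congr diag_mx; apply/rowP => j; rewrite !mxE.
  by case: eqP; rewrite ?mulr1 ?mulr0.
exists (B *m E + P); split.
- apply/unitarymxP; rewrite linearD /= map_mxD trmxC_mul E' P' mulmxDl !mulmxDr.
  rewrite !mulmxA -(mulmxA B) -(mulmxA B E P) EP mulmx0 addr0 PE mul0mx add0r PP.
  rewrite mulmxA -EB -[E *m B *m E]mulmxA -EB -!mulmxA BB.
  rewrite /E /s2 /P !dM -raddfD /= -diag_const_mx.
  congr diag_mx; apply/rowP => j; rewrite !mxE.
  case: eqVneq => [->|f0]; first by rewrite invr0 mul0r add0r.
  by rewrite addr0 expr2 mulKf // mulVf.
- rewrite mulmxDl -mulmxA /E /P /s !dM.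
  rewrite [X in _ + diag_mx X](_ : _ = 0); last first.
    apply/rowP => j; rewrite !mxE.
    by case: eqVneq => [->|_]; rewrite ?mulr0 ?mul0r.
  rewrite linear0 addr0.
  apply/eqP; rewrite -subr_eq0 -{2}[B]mulmx1 -mulmxBr -oppr_eq0 -mulmxN opprB.
  rewrite -[X in _ == X]BP; apply/eqP; congr (_ *m _).
  rewrite -diag_const_mx -raddfB /=; congr diag_mx.
  apply/rowP => j; rewrite !mxE.
  by case: eqVneq => [->|f0]; rewrite ?invr0 ?mul0r ?subr0 // mulVf // subrr.
- rewrite mulmxDl mulmxDr mulmxA cB -!mulmxA; congr (_ *m _ + _); exact: diag_mxC.
Qed.

Lemma scale_unitarymx n (a : C) (M : 'M[C]_n) :
  `|a| = 1 -> M \is unitarymx -> a *: M \is unitarymx.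
Proof.
move=> a1 uM; apply/unitarymxP; rewrite linearZ /= map_mxZ.
rewrite -scalemxAl -scalemxAr scalerA (unitarymxP uM).
by rewrite -normCK a1 expr1n scale1r.
Qed.

Lemma trmxC_hermitian n (A : 'M[C]_n) : A \is hermsymmx -> A^t* = A.
Proof. by move=> /is_hermitianmxP; rewrite expr0 scale1r => <-. Qed.

(** The three equations say that the matrix (A, B; - B^*, D) is unitary.  For
    an eigenvalue c + i s, the columns x of [X] and y of [Y] satisfy A x = c x,
    D y = c y, B y = i s x and - B^* x = i s y: diagonalising [A] and [D]
    together gives y, and the unitary part of [B] then gives x. *)
Lemma paired_eigenvectors n (A B D W : 'M[C]_n) :
  A \is hermsymmx -> W \is unitarymx -> A = W *m D *m W^t* ->
  A *m A + B *m B^t* = 1%:M -> B^t* *m B + D *m D = 1%:M ->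
  A *m B = B *m D ->
  exists (X Y : 'M[C]_n) (l : 'rV[C]_n),
    [/\ X \is unitarymx, Y \is unitarymx, forall j, `|l 0 j| = 1,
        A *m X + B *m Y = X *m diag_mx l
      & - B^t* *m X + D *m Y = Y *m diag_mx l].
Proof.
move=> hA uW AD AABB BBDD AB.
have /hermitian_normalmx/orthomx_spectralP := hA.
have := hermitian_spectral_diag_real hA.
move: (spectralmx A) (spectral_diag A) (spectral_unitarymx A) => P c uP rc.
rewrite invmx_unitary // => AE.
pose Z := P^t*; have uZ : Z \is unitarymx by rewrite trmxC_unitary.
have PZ : Z^t* = P by rewrite trmxCK.
have AZ : A *m Z = Z *m diag_mx c by rewrite AE mulmxtVK.
pose Y := W^t* *m Z.
have uY : Y \is unitarymx by rewrite mul_unitarymx ?trmxC_unitary.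
have DY : D *m Y = Y *m diag_mx c.
  rewrite -mulmxA -AZ AD !mulmxA (trmxC_mul_unitary uW) mul1mx.
  by rewrite -!mulmxA.
have ZA : Z^t* *m A = diag_mx c *m Z^t*.
  by rewrite AE PZ !mulmxA (unitarymxP uP) mul1mx.
clearbody Z Y.
pose B0 := Z^t* *m B *m Y.
have cr j : c 0 j \is Num.real by apply: (mxOverP rc).
have cc : diag_mx c *m diag_mx c = diag_mx (map_mx (fun x => x ^+ 2) c).
  by rewrite mulmx_diag; congr diag_mx; apply/rowP => j; rewrite !mxE expr2.
have BB0 : B0 *m B0^t* = 1%:M - diag_mx (map_mx (fun x => x ^+ 2) c).
  rewrite /B0 !trmxC_mul trmxCK mulmxA (mulmxtVK _ uY) -(mulmxA _ B).
  rewrite (mulmxA B) -[B *m _](addKr (A *m A)) AABB addrC mulmxBl mul1mx.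
  rewrite mulmxBr (trmxC_mul_unitary uZ) -(mulmxA A) AZ (mulmxA A) AZ !mulmxA.
  by rewrite (trmxC_mul_unitary uZ) mul1mx cc.
have B0B : B0^t* *m B0 = 1%:M - diag_mx (map_mx (fun x => x ^+ 2) c).
  rewrite /B0 !trmxC_mul trmxCK !mulmxA (mulmxtVK _ uZ) -!mulmxA.
  rewrite (mulmxA (B^t*)) -[B^t* *m B](addrK (D *m D)) BBDD mulmxBl mul1mx.
  rewrite mulmxBr (trmxC_mul_unitary uY) -(mulmxA D) DY (mulmxA D) DY !mulmxA.
  by rewrite (trmxC_mul_unitary uY) mul1mx cc.
have cB0 : diag_mx c *m B0 = B0 *m diag_mx c.
  by rewrite /B0 !mulmxA -ZA -(mulmxA _ A B) AB -!mulmxA DY.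
(* The absolute value makes f real everywhere; at the eigenvalues of A the
   number 1 - x ^ 2 is nonnegative, being a squared row norm of B0. *)
pose f (x : C) := sqrtC `|1 - x ^+ 2|.
have fR x : f x \is Num.real by rewrite ger0_real // sqrtC_ge0.
have f2 j : f (c 0 j) ^+ 2 = 1 - c 0 j ^+ 2.
  rewrite sqrtCK ger0_norm //.
  have /matrixP/(_ j j) := BB0; rewrite !mxE eqxx !mulr1n => <-.
  by apply: sumr_ge0 => k _; rewrite !mxE mul_conjC_ge0.
have s2 : 1%:M - diag_mx (map_mx (fun x => x ^+ 2) c)
    = diag_mx (map_mx (fun x => f x ^+ 2) c).
  rewrite -diag_const_mx -raddfB /=; congr diag_mx; apply/rowP => j.
  by rewrite !mxE f2.
have [||R [uR RB cR]] := commuting_polar fR _ _ cB0; rewrite -?s2 //.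
pose S := diag_mx (map_mx f c).
have SS : S^t* = S.
  rewrite tr_diag_mx map_diag_mx; congr diag_mx; apply/rowP => j.
  by rewrite !mxE; apply/CrealP.
exists (- 'i *: (Z *m R)), Y, (\row_j (c 0 j + 'i * f (c 0 j))).
have lE : diag_mx (\row_j (c 0 j + 'i * f (c 0 j))) = diag_mx c + 'i *: S.
  rewrite -linearZ -raddfD /=; congr diag_mx; apply/rowP => j.
  by rewrite !mxE.
have BY : B *m Y = Z *m R *m S.
  by rewrite -mulmxA RB !mulmxA (unitarymxP uZ) mul1mx.
have BZ : B^t* *m (Z *m R) = Y *m S.
  have BZ0 : B^t* *m Z = Y *m B0^t*.
    by rewrite !trmxC_mul trmxCK !mulmxA (unitarymxP uY) mul1mx.
  rewrite mulmxA BZ0 -RB trmxC_mul SS -!mulmxA.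
  by rewrite (trmxC_mul_unitary uR) mulmx1.
split=> //.
- apply: scale_unitarymx; last exact: mul_unitarymx.
  by rewrite normrN normCi.
- move=> j; rewrite mxE; apply/eqP; rewrite -sqrp_eq1 //.
  by rewrite normC2_rect // f2 addrC subrK.
- rewrite BY lE -scalemxAr -scalemxAl (mulmxA A) AZ -(mulmxA Z (diag_mx c)) cR mulmxDr.
  rewrite -scalemxAr scalerDr scalerA mulNr -expr2 sqrCi opprK scale1r.
  by rewrite mulmxA.
- rewrite mulNmx -scalemxAr BZ DY lE mulmxDr -scalemxAr scaleNr opprK.
  by rewrite addrC.
Qed.

Lemma trmxC_block m1 m2 n1 n2 (a : 'M[C]_(m1, n1)) (b : 'M[C]_(m1, n2))
    (c : 'M[C]_(m2, n1)) (d : 'M[C]_(m2, n2)) :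
  (block_mx a b c d)^t* = block_mx (a^t*) (c^t*) (b^t*) (d^t*).
Proof. by rewrite tr_block_mx map_block_mx. Qed.

Definition grading n : 'M[C]_(n + n) := block_mx 1%:M 0 0 (- 1%:M).

Lemma grading_unitary n : grading n \is unitarymx.
Proof.
apply/unitarymxP; rewrite trmxC_block mulmx_block.
rewrite linearN /= map_mxN !trmx0 !map_mx0 trmx1 map_mx1.
rewrite ?(mul1mx, mulmx1, mul0mx, mulmx0, add0r, addr0, mulNmx, mulmxN).
by rewrite opprK -scalar_mx_block.
Qed.

(** The unitary matrix here is grading G grading G^*.  Its diagonal blocks are
    A = 2 a a^* - 1 and D = 2 d d^* - 1, and they are similar through the chain
    a a^* ~ a^* a = 1 - c^* c ~ 1 - c c^* = d d^*. *)
Lemma eigenframe_block n (G : 'M[C]_(n + n)) : G \is unitarymx ->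
  exists (L : 'M[C]_(n + n, n)) (l : 'rV[C]_n),
    [/\ L^t* *m L = 1%:M, L^t* *m (grading n *m L) = 0, forall j, `|l 0 j| = 1
      & grading n *m G *m grading n *m G^t* *m L = L *m diag_mx l].
Proof.
rewrite -[G]submxK; move: (ulsubmx G) (ursubmx G) (dlsubmx G) (drsubmx G).
move=> a b c d uG.
have := unitarymxP uG; rewrite trmxC_block [in X in X -> _]mulmx_block.
rewrite (scalar_mx_block n n (1 : C)) => /eq_block_mx[ab _ _ cd].
have := trmxC_mul_unitary uG; rewrite trmxC_block [in X in X -> _]mulmx_block.
rewrite (scalar_mx_block n n (1 : C)) => /eq_block_mx[a'c _ _ _].
have gG : grading n *m block_mx a b c d *m grading n = block_mx a (- b) (- c) d.
  rewrite /grading !mulmx_block.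
  rewrite ?(mul1mx, mulmx1, mul0mx, mulmx0, add0r, addr0, mulNmx, mulmxN).
  by rewrite opprK.
have [W1 uW1 aW1] := gram_similar a.
have [W2 uW2 cW2] := gram_similar (c^t*); rewrite trmxCK in cW2.
set A := a *m a^t* - b *m b^t*; pose B := a *m c^t* - b *m d^t*.
set D := d *m d^t* - c *m c^t*.
have UE : grading n *m block_mx a b c d *m grading n *m
    block_mx (a^t*) (c^t*) (b^t*) (d^t*) = block_mx A B (- B^t*) D.
  rewrite gG mulmx_block /A /B /D !mulNmx; congr block_mx; last by rewrite addrC.
  by rewrite linearB /= map_mxB !trmxC_mul !trmxCK opprB addrC.
have AE : A = (a *m a^t*) *+ 2 - 1%:M.
  by rewrite mulr2n -ab opprD addrACA subrr add0r.
have DE : D = 1%:M - (c *m c^t*) *+ 2.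
  by rewrite -cd mulr2n opprD addrACA subrr add0r.
have hA : A \is hermsymmx.
  apply/is_hermitianmxP; rewrite expr0 scale1r /A linearB /= map_mxB.
  by rewrite !trmxC_mul !trmxCK.
have hD : D^t* = D by rewrite /D linearB /= map_mxB !trmxC_mul !trmxCK.
pose W := W1 *m W2.
have uW : W \is unitarymx by exact: mul_unitarymx.
have AW : A = W *m D *m W^t*.
  have W12 : W *m (c *m c^t*) *m W^t* = 1%:M - a *m a^t*.
    rewrite (_ : W *m _ *m _ = W1 *m (W2 *m (c *m c^t*) *m W2^t*) *m W1^t*).
      by rewrite -cW2 -[c^t* *m c](addKr (a^t* *m a)) a'c addrC mulmxBr mulmx1
        mulmxBl (unitarymxP uW1) -aW1.
    by rewrite /W trmxC_mul !mulmxA.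
  rewrite DE mulmxBr mulmx1 mulmxBl (unitarymxP uW) mulr2n mulmxDr mulmxDl.
  by rewrite -mulr2n W12 AE mulrnBl opprB addrCA [1%:M *+ 2]mulr2n opprD addNKr.
have UU : block_mx A B (- B^t*) D \is unitarymx.
  by rewrite -UE -trmxC_block !mul_unitarymx ?trmxC_unitary ?grading_unitary.
have := unitarymxP UU; rewrite trmxC_block mulmx_block.
rewrite (scalar_mx_block n n (1 : C)) => /eq_block_mx[AABB ABBD _ BBDD].
rewrite (trmxC_hermitian hA) in AABB ABBD.
have [X [Y [l [uX uY l1 UX UY]]]] :
  exists (X Y : 'M[C]_n) (l : 'rV[C]_n),
    [/\ X \is unitarymx, Y \is unitarymx, forall j, `|l 0 j| = 1,
        A *m X + B *m Y = X *m diag_mx l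
      & - B^t* *m X + D *m Y = Y *m diag_mx l].
  apply: paired_eigenvectors hA uW AW AABB _ _.
    by rewrite -BBDD hD linearN /= map_mxN mulmxN mulNmx opprK trmxCK.
  apply/eqP; rewrite -subr_eq0 -oppr_eq0 opprB addrC; apply/eqP.
  by rewrite -[RHS]ABBD hD linearN /= map_mxN trmxCK mulmxN.
(* X and Y have orthonormal columns, so the stacked columns have norm sqrt 2. *)
pose r : C := sqrtC 2^-1.
have rr : r^* * r = 2^-1 :> C.
  by rewrite conj_Creal -?expr2 ?sqrtCK // ger0_real // sqrtC_ge0 invr_ge0 ler0n.
exists (r *: col_mx X Y), l.
have tr : (r *: col_mx X Y)^t* = r^* *: row_mx (X^t*) (Y^t*).
  by rewrite linearZ /= map_mxZ tr_col_mx map_row_mx.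
have half (M : 'M[C]_(n + n, n)) :
    (r *: col_mx X Y)^t* *m (r *: M) = 2^-1 *: (row_mx (X^t*) (Y^t*) *m M).
  by rewrite tr -scalemxAr -scalemxAl scalerA mulrC rr.
split=> //.
- rewrite half mul_row_col !trmxC_mul_unitary // -mulr2n -(scaler_nat 2 1%:M) scalerA.
  by rewrite mulVf ?scale1r // pnatr_eq0.
- rewrite -scalemxAr half mul_block_col !mul1mx !mul0mx addr0 add0r mulNmx mul1mx.
  by rewrite mul_row_col mulmxN !trmxC_mul_unitary // subrr scaler0.
- by rewrite -scalemxAr UE mul_block_col UX UY -mul_col_mx scalemxAl.
Qed.

Lemma orthonormal_rows m p k (V : 'M[C]_(m, p)) : \rank V = k ->
  exists2 E : 'M[C]_(k, p), E \is unitarymx & (E <= V)%MS.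
Proof.
case: _ /; exists (schmidt (row_base V)).
  by rewrite schmidt_unitarymx ?rank_leq_col.
by rewrite eqmx_schmidt_free ?row_base_free // eq_row_base.
Qed.

Lemma unitary_involution_trmxC n (Gam : 'M[C]_n) :
  Gam \is unitarymx -> Gam *m Gam = 1%:M -> Gam^t* = Gam.
Proof. by move=> uG GG; rewrite -[LHS]mul1mx -GG (mulmxtVK _ uG). Qed.

(** Orthonormal bases of the two eigenspaces fit together into an orthonormal
    basis because a unitary involution is Hermitian; the equal dimensions make
    the two blocks equal in size. *)
Lemma grading_frame n (Gam : 'M[C]_(n + n)) :
  Gam \is unitarymx -> Gam *m Gam = 1%:M ->
  \rank (eigenspace Gam^T 1) = n -> \rank (eigenspace Gam^T (-1)) = n ->
  exists2 P, P \is unitarymx & Gam = P *m grading n *m P^t*.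
Proof.
move=> uG GG /orthonormal_rows[E1 uE1 /eigenspaceP E1P].
move=> /orthonormal_rows[E2 uE2 /eigenspaceP E2P].
have hG := unitary_involution_trmxC uG GG.
have GT : (Gam^T)^t* = Gam^T by rewrite -{2}hG map_trmx !trmxK.
have E12 : E1 *m E2^t* = 0.
  have e : E1 *m E2^t* = - (E1 *m E2^t*).
    rewrite -{1}[E1]scale1r -E1P -mulmxA -{1}GT -trmxC_mul E2P scaleN1r.
    by rewrite linearN /= map_mxN mulmxN.
  have /eqP : 2%:R *: (E1 *m E2^t*) = 0 by rewrite scaler_nat mulr2n {2}e subrr.
  by rewrite scaler_eq0 pnatr_eq0 => /eqP.
have uE : (col_mx E1 E2)^T \is unitarymx.
  rewrite trmx_unitary; apply/unitarymxP.
  rewrite tr_col_mx map_row_mx mul_col_row (unitarymxP uE1) (unitarymxP uE2) E12.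
  by rewrite -(trmxCK (E2 *m _)) trmxC_mul trmxCK E12 trmx0 map_mx0 -scalar_mx_block.
exists (col_mx E1 E2)^T => //.
have GE : Gam *m (col_mx E1 E2)^T = (col_mx E1 E2)^T *m grading n.
  rewrite -[Gam]trmxK -trmx_mul mul_col_mx E1P E2P scale1r scaleN1r.
  rewrite !tr_col_mx mul_row_block !mulmx0 !mulmx1 addr0 add0r mulmxN mulmx1.
  by rewrite linearN.
by rewrite -GE (mulmxtVK _ uE).
Qed.

(** The eigenvalues on [Gam *m L] are the conjugates of those on [L] since
    Gam U Gam = U^* for U = Gam G Gam G^*. *)
Lemma eigenframe n (Gam G : 'M[C]_(n + n)) :
  Gam \is unitarymx -> Gam *m Gam = 1%:M ->
  \rank (eigenspace Gam^T 1) = n -> \rank (eigenspace Gam^T (-1)) = n ->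
  G \is unitarymx ->
  exists (L : 'M[C]_(n + n, n)) (l : 'rV[C]_n),
    [/\ row_mx L (Gam *m L) \is unitarymx, forall j, `|l 0 j| = 1
      & Gam *m G *m Gam *m G^t* *m row_mx L (Gam *m L)
        = row_mx L (Gam *m L) *m diag_mx (row_mx l (map_mx Num.conj l))].
Proof.
move=> uGam GG e1 eN1 uG.
have [P uP GE] := grading_frame uGam GG e1 eN1.
have uG' : P^t* *m G *m P \is unitarymx by rewrite !mul_unitarymx ?trmxC_unitary.
have [L [l [LL LJL l1 UL]]] := eigenframe_block uG'.
have hGam := unitary_involution_trmxC uGam GG.
pose M := P *m L.
have PP := trmxC_mul_unitary uP.
have MM : M^t* *m M = 1%:M by rewrite trmxC_mul mulmxA -(mulmxA _ _ P) PP mulmx1.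
have MGM : M^t* *m (Gam *m M) = 0.
  rewrite trmxC_mul GE -!mulmxA (mulmxA (P^t*) P) PP mul1mx.
  by rewrite (mulmxA (P^t*) P) PP mul1mx.
have UM : Gam *m G *m Gam *m G^t* *m M = M *m diag_mx l.
  by rewrite /M -(mulmxA P) -UL !trmxC_mul trmxCK GE !mulmxA.
have UGM : Gam *m G *m Gam *m G^t* *m (Gam *m M)
    = Gam *m M *m diag_mx (map_mx Num.conj l).
  have ll : diag_mx l *m diag_mx (map_mx Num.conj l) = 1%:M.
    rewrite mulmx_diag -diag_const_mx; congr diag_mx; apply/rowP => j.
    by rewrite !mxE -normCK l1 expr1n.
  pose U := Gam *m G *m Gam *m G^t*.
  have GUG : Gam *m U *m Gam *m U = 1%:M.
    rewrite /U !mulmxA GG mul1mx -(mulmxA (G *m Gam *m G^t*)) GG mulmx1.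
    rewrite -(mulmxA _ _ G) (trmxC_mul_unitary uG) mulmx1 -(mulmxA G) GG mulmx1.
    exact: unitarymxP.
  have UG (X : 'M[C]_(n + n, n)) : U *m (Gam *m (U *m X)) = Gam *m X.
    by rewrite -[in RHS](mul1mx X) -GUG !mulmxA GG mul1mx.
  have ME : M = U *m (M *m diag_mx (map_mx Num.conj l)).
    by rewrite mulmxA UM -mulmxA ll mulmx1.
  by rewrite -/U {1}ME UG mulmxA.
exists M, l; split=> //.
  rewrite -trmxC_unitary; apply/unitarymxP; rewrite trmxCK tr_row_mx map_col_mx.
  rewrite mul_col_row MM MGM trmxC_mul hGam -!mulmxA (mulmxA Gam) GG mul1mx MM.
  by rewrite MGM -scalar_mx_block.
by rewrite mul_mx_row UM UGM diag_mx_row mul_row_block !mulmx0 addr0 add0r.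
Qed.

Lemma eigenframe_columns n (Gam U : 'M[C]_(n + n)) (L : 'M[C]_(n + n, n))
    (l : 'rV[C]_n) (Q := row_mx L (Gam *m L))
    (lam := row_mx l (map_mx Num.conj l)) :
  U *m Q = Q *m diag_mx lam ->
  (forall j, U *m col j Q = lam 0 j *: col j Q) /\
  forall j k : 'I_(n + n), (j < n)%N -> k = (n + j)%N :> nat ->
    Gam *m col j Q = col k Q /\ (lam 0 j)^* = lam 0 k.
Proof.
have colM p q (A : 'M[C]_(n + n, p)) (B : 'M[C]_(p, q)) j :
  A *m col j B = col j (A *m B) by rewrite !colE mulmxA.
move=> UQ; split=> [j|j k].
  rewrite colM UQ mul_mx_diag; apply/colP => i.
  by rewrite !mxE mulrC.
case: (split_ordP j) => {}j -> /=; last by [].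
move=> _ kE; have -> : k = rshift n j by exact/val_inj.
by rewrite colKl colKr colM /lam row_mxEl row_mxEr mxE.
Qed.

Lemma eigenframe_modulus n (l : 'rV[C]_n) : (forall j, `|l 0 j| = 1) ->
  forall j, `|row_mx l (map_mx Num.conj l) 0 j| = 1.
Proof.
move=> l1 j; case: (split_ordP j) => {}j ->; rewrite ?row_mxEl ?row_mxEr //.
by rewrite mxE norm_conjC.
Qed.

Lemma unitary_orthonormal_basis n (Q : 'M[C]_n) :
  Q \is unitarymx -> orthonormal_basis (fun j => col j Q).
Proof.
move=> uQ; have QQ := trmxC_mul_unitary uQ; split; last first.
  move=> i j; rewrite dotmxE eq_sym; have /matrixP/(_ j i) := QQ; rewrite !mxE => <-.
  by apply: eq_bigr => k _; rewrite !mxE mulrC.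
have -> : codom (fun j => col j Q) = [tuple col j Q | j < n] by [].
rewrite basisEfree subvf dimvf size_tuple /=; apply/andP; split; last first.
  by rewrite /dim /= muln1.
apply/(@freeP C _ n [tuple col j Q | j < n]) => k k0 i.
have {}k0 : Q *m (\col_j k j) = 0.
  rewrite -k0; apply/colP => r; rewrite mxE summxE; apply: eq_bigr => j _.
  by rewrite -tnth_nth tnth_mktuple !mxE mulrC.
have := congr1 (fun v => Q^t* *m v) k0; rewrite mulmxA QQ mul1mx mulmx0.
by move/colP/(_ i); rewrite !mxE.
Qed.

(** The matrix is M - Gam M Gam for M = L t L^*, and conjugation by [Gam]
    exchanges the two terms. *)
Lemma paired_generator n (Gam : 'M[C]_(n + n)) (L : 'M[C]_(n + n, n)) (t : 'rV[C]_n)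
    (Q := row_mx L (Gam *m L)) (A := Q *m diag_mx (row_mx t (- t)) *m Q^t*) :
  Gam^t* = Gam -> Gam *m Gam = 1%:M -> (forall j, t 0 j \is Num.real) ->
  A \is hermsymmx /\ Gam *m A = - (A *m Gam).
Proof.
move=> hG GG tR.
have AE : A = L *m diag_mx t *m L^t* - Gam *m L *m diag_mx t *m L^t* *m Gam.
  rewrite /A /Q diag_mx_row tr_row_mx map_col_mx mul_row_block !mulmx0 addr0 add0r.
  by rewrite mul_row_col trmxC_mul hG linearN /= mulmxN mulNmx !mulmxA.
have tt : (diag_mx t)^t* = diag_mx t.
  rewrite tr_diag_mx map_diag_mx; congr diag_mx; apply/rowP => j.
  by rewrite !mxE; apply/CrealP.
split.
  apply/is_hermitianmxP; rewrite expr0 scale1r AE linearB /= map_mxB.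
  by rewrite !trmxC_mul !trmxCK tt hG !mulmxA.
rewrite AE mulmxBl mulmxBr !mulmxA GG mul1mx opprB.
by rewrite -(mulmxA _ Gam) GG mulmx1.
Qed.

(** The hypotheses are those of two solutions of the evolution equation at one
    time, and the left-hand side is the derivative of their product. *)
Lemma skew_product0 n (A U V : 'M[C]_n) : A \is hermsymmx ->
  (- 'i *: (A *m U))^t* *m V + U^t* *m (- 'i *: (A *m V)) = 0.
Proof.
move=> hA; rewrite linearZ /= map_mxZ trmxC_mul (trmxC_hermitian hA).
rewrite -scalemxAl -scalemxAr mulmxA -scalerDl.
by rewrite rmorphN /= conjCi opprK subrr scale0r.
Qed.

(** The right-hand side is the generator [B] applied to the conjugate of [U]:
    this is how the time reversal of a solution is again a solution. *)
Lemma chiral_generator n (Gam A B U : 'M[C]_n) :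
  Gam *m Gam = 1%:M -> Gam *m A *m Gam = - B ->
  Gam *m ('i *: (A *m U)) *m Gam = - 'i *: (B *m (Gam *m U *m Gam)).
Proof.
move=> GG GAG; rewrite -scalemxAr -scalemxAl scaleNr -scalerN -mulNmx -GAG.
by rewrite !mulmxA -(mulmxA _ Gam Gam) GG mulmx1.
Qed.

Lemma expr_unitary_diag n (Q : 'M[C]_n) (d : 'rV[C]_n) k : Q \is unitarymx ->
  (Q *m diag_mx d *m Q^t*) ^+ k = Q *m diag_mx (map_mx (fun x => x ^+ k) d) *m Q^t*.
Proof.
move=> uQ; elim: k => [|k IHk].
  rewrite expr0 (_ : map_mx _ _ = const_mx 1) ?diag_const_mx.
    by rewrite mulmx1 (unitarymxP uQ).
  by apply/rowP => j; rewrite !mxE.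
rewrite exprS IHk -[_ * _]/(_ *m _) !mulmxA (mulmxKtV _ uQ) //.
rewrite -(mulmxA Q) mulmx_diag; congr (_ *m diag_mx _ *m _).
by apply/rowP => j; rewrite !mxE exprS.
Qed.

Lemma sum_expr_unitary_diag n (Q : 'M[C]_n) (d : 'rV[C]_n) (a : nat -> C) m :
  Q \is unitarymx ->
  \sum_(0 <= k < m) a k *: (Q *m diag_mx d *m Q^t*) ^+ k
  = Q *m diag_mx (\row_j \sum_(0 <= k < m) a k * d 0 j ^+ k) *m Q^t*.
Proof.
move=> uQ.
have -> : \row_j \sum_(0 <= k < m) a k * d 0 j ^+ k
    = \sum_(0 <= k < m) a k *: map_mx (fun x => x ^+ k) d.
  by apply/rowP => j; rewrite mxE summxE; apply: eq_bigr => k _; rewrite !mxE.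
rewrite raddf_sum mulmx_sumr mulmx_suml; apply: eq_bigr => k _.
by rewrite expr_unitary_diag //= linearZ /= -scalemxAr -scalemxAl.
Qed.

Lemma exprNi k : (- 'i : C) ^+ k =
  (~~ odd k)%:R * (-1) ^+ k./2 - 'i * ((odd k)%:R * (-1) ^+ k.-1./2).
Proof.
rewrite -{1}(odd_double_half k) exprD -mul2n exprM sqrrN sqrCi.
case: (boolP (odd k)) => ok /=.
  have -> : k.-1./2 = k./2 by rewrite -{1}(odd_double_half k) ok /= doubleK.
  by rewrite mul0r mul1r sub0r mulNr.
by rewrite expr0 !mul1r mul0r mulr0 subr0.
Qed.

End Unitary.

(** * Complex-valued functions of a real variable *)

Section ComplexCurves.
Variable R : realType.
Local Open Scope classical_set_scope.
Implicit Types (u v : R -> Cplx R) (t : R).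

(** The scalar case of [has_mxderiv]: every statement about matrix derivatives
    below is reduced to it, entry by entry. *)
Definition cderiv u t (d : Cplx R) :=
  (real_complex R h : Cplx R)^-1 * (u (t + h) - u t) @[h --> 0^'] --> d.

Lemma near_eq_cvg_to (T : Type) (F : set_system T) {FF : Filter F}
    (V : topologicalType) (f g : T -> V) (l : V) :
  f x @[x --> F] --> l -> (\forall x \near F, f x = g x) ->
  g x @[x --> F] --> l.
Proof. by move=> fl fg; apply: cvg_trans fl; exact: near_eq_cvg. Qed.

Lemma cvg_real_complex (T : Type) (F : set_system T) {FF : Filter F}
    (f : T -> R) (l : R) :
  f x @[x --> F] --> l ->
  (real_complex R (f x) : Cplx R) @[x --> F] --> (real_complex R l : Cplx R).
Proof.
move=> /cvgrPdist_lt fl; apply/cvgrPdist_lt => e e0.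
have eR : (Re e)%:C%C = e by apply: RRe_real; rewrite realE ltW.
have := fl (Re e); rewrite -ltcR eR => /(_ e0); apply: filterS => x fx.
by rewrite -raddfB /= normc_def /= expr0n addr0 sqrtr_sqr -eR ltcR.
Qed.

Lemma cvg_Re (T : Type) (F : set_system T) {FF : Filter F}
    (f : T -> Cplx R) (l : Cplx R) :
  f x @[x --> F] --> l -> Re (f x) @[x --> F] --> Re l.
Proof.
move=> /cvgrPdist_lt fl; apply/cvgrPdist_lt => e e0.
have := fl e%:C%C; rewrite ltcR => /(_ e0); apply: filterS => x.
move=> /(le_lt_trans (normc_ge_Re _)); rewrite ltcR.
by rewrite raddfB.
Qed.

Lemma cvg_conj (T : Type) (F : set_system T) {FF : Filter F}
    (f : T -> Cplx R) (l : Cplx R) :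
  f x @[x --> F] --> l -> (f x)^* @[x --> F] --> l^*.
Proof.
move=> /cvgrPdist_lt fl; apply/cvgrPdist_lt => e e0.
by have := fl e e0; apply: filterS => x; rewrite -rmorphB norm_conjC.
Qed.

Lemma cvg_sum (I : finType) (T : Type) (F : set_system T) {FF : Filter F}
    (f : I -> T -> Cplx R) (l : I -> Cplx R) :
  (forall i, f i x @[x --> F] --> l i) ->
  (\sum_i f i x) @[x --> F] --> \sum_i l i.
Proof.
by move=> fl; apply: (cvg_big add_continuous) => // i _; exact: fl.
Qed.

Lemma cderiv_cst (a : Cplx R) t : cderiv (fun=> a) t 0.
Proof. by rewrite /cderiv; under eq_fun do rewrite subrr mulr0; exact: cvg_cst. Qed.

Lemma cderiv_continuous u t d : cderiv u t d -> u (t + h) @[h --> 0^'] --> u t.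
Proof.
move=> ud.
have h0 : (real_complex R h : Cplx R) @[h --> 0^'] --> 0.
  have id0 : (h : R) @[h --> (0 : R)^'] --> (0 : R) by exact: cvg_within.
  exact: cvg_real_complex id0.
pose proof (H := cvgD (cvgM h0 ud) (cvg_cst (u t))).
rewrite mul0r add0r in H.
apply: near_eq_cvg_to H _.
near=> h; have h_neq0 : h != 0 by near: h; exact: nbhs_dnbhs_neq.
by rewrite /= mulrA divff ?fmorph_eq0 // mul1r subrK.
Unshelve. all: by end_near. Qed.

Lemma cderivM u v t d e :
  cderiv u t d -> cderiv v t e -> cderiv (u \* v) t (d * v t + u t * e).
Proof.
move=> ud ve.
pose proof (H := cvgD (cvgM ud (cderiv_continuous ve))
  (cvgM (cvg_cst (u t)) ve)).
apply: near_eq_cvg_to H _.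
by near=> h; rewrite /=; ring.
Unshelve. all: by end_near. Qed.

Lemma cderiv_sum (I : finType) (u : I -> R -> Cplx R) t (d : I -> Cplx R) :
  (forall i, cderiv (u i) t (d i)) -> cderiv (fun x => \sum_i u i x) t (\sum_i d i).
Proof.
move=> ud; pose proof (H := cvg_sum ud).
apply: near_eq_cvg_to H _.
by near=> h; rewrite /= -sumrB mulr_sumr.
Unshelve. all: by end_near. Qed.

Lemma cderiv_conj u t d : cderiv u t d -> cderiv (fun x => (u x)^*) t (d^*).
Proof.
move=> /cvg_conj H; apply: near_eq_cvg_to H _.
near=> h; rewrite /= rmorphM rmorphB fmorphV /=; congr (_^-1 * _).
by apply: conjc_real.
Unshelve. all: by end_near. Qed.

Lemma cderiv_opp u t d : cderiv u (- t) d -> cderiv (fun x => u (- x)) t (- d).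
Proof.
move=> ud; rewrite /cderiv.
have hN : - h @[h --> (0 : R)^'] `=>` (0 : R)^'.
  move=> A; rewrite -{1}oppr0 dnbhsN => -[B B0 <-].
  by apply: filterS B0 => h Bh; exists h.
pose proof (H := cvgN (cvg_comp _ _ hN ud)).
apply: near_eq_cvg_to H _.
by near=> h; rewrite /= rmorphN invrN mulNr opprK opprD.
Unshelve. all: by end_near. Qed.

Lemma cderiv_shift u t a d :
  cderiv u (t + a) d -> cderiv (fun x => u (x + a)) t d.
Proof. by rewrite /cderiv; under eq_fun do rewrite addrAC. Qed.

(** Taking real parts turns the complex difference quotient into the real one,
    to which the mean value theorem applies. *)
Lemma Re_cderiv0 u x y : (forall t, cderiv u t 0) -> Re (u x) = Re (u y).
Proof.
move=> u0; apply: (@is_derive_0_is_cst R (fun t => Re (u t))) => {x y} t.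
have uR : h^-1 *: (Re (u (h *: 1 + t)) - Re (u t)) @[h --> (0:R)^'] --> (0 : R).
  pose proof (H := cvg_Re (u0 t)).
  apply: near_eq_cvg_to H _.
  near=> h; rewrite /= -fmorphV /= [h *: 1]mulr1 (addrC h t).
  by case: (u _) => a b; case: (u t) => a' b' /=; rewrite mul0r subr0.
apply: DeriveDef; first by apply: cvgP uR.
by apply: (cvg_lim _ uR); exact: norm_hausdorff.
Unshelve. all: by end_near. Qed.

Lemma cderiv0_cst u x y : (forall t, cderiv u t 0) -> u x = u y.
Proof.
move=> u0; apply/eqP; rewrite eq_complex (Re_cderiv0 x y u0) eqxx /=.
have iu0 t : cderiv (fun t => u t * 'i%C) t 0.
  by have := cderivM (u0 t) (cderiv_cst 'i%C t); rewrite mul0r mulr0 addr0.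
by have := Re_cderiv0 x y iu0; rewrite !ReiNIm => /oppr_inj ->.
Qed.

End ComplexCurves.

(** * Time evolution *)

Section Evolution.
Variables (R : realType) (n : nat).
Local Notation C := (Cplx R).
Local Notation M := 'M[C]_n.
Local Open Scope classical_set_scope.
Local Open Scope sesquilinear_scope.
Implicit Types (U V H : R -> M) (t : R).

Definition mxcderiv U t (D : M) :=
  forall i j, cderiv (fun x => U x i j) t (D i j).

Definition solves H U := forall t, mxcderiv U t (- 'i *: (H t *m U t)).

Lemma has_mxderiv_coord U t D : has_mxderiv U t D -> mxcderiv U t D.
Proof.
move=> UD i j.
pose q h : M := (real_complex R h : C)^-1 *: (U (t + h) - U t).
pose proof (K := cvg_comp q (fun A : M => A i j) UD
  (@coord_continuous C n n i j D)).
rewrite /cderiv; apply: near_eq_cvg_to K _.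
by near=> h; rewrite /q /= !mxE.
Unshelve. all: by end_near. Qed.

Lemma mxcderivM U V t D E :
  mxcderiv U t D -> mxcderiv V t E ->
  mxcderiv (fun x => U x *m V x) t (D *m V t + U t *m E).
Proof.
move=> UD VE i j.
have -> : (fun x => (U x *m V x) i j) = (fun x => \sum_k U x i k * V x k j).
  by apply/funext => x; rewrite mxE.
rewrite !mxE -big_split; apply: cderiv_sum => k.
exact: cderivM (UD i k) (VE k j).
Qed.

Lemma mxcderiv_trmxC U t D :
  mxcderiv U t D -> mxcderiv (fun x => (U x)^t*) t (D^t*).
Proof.
move=> UD i j; have := cderiv_conj (UD j i).
rewrite !mxE; congr cderiv; apply/funext => x.
by rewrite !mxE.
Qed.

Lemma mxcderiv_cst (A : M) t : mxcderiv (fun=> A) t 0.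
Proof. by move=> i j; rewrite mxE; exact: cderiv_cst. Qed.

Lemma evolution_solves H U : evolution H U -> solves H U.
Proof. by move=> [_ UH] t; exact: has_mxderiv_coord. Qed.

(** The conservation law: the contributions - i H of [V] and i H of [U^t*]
    to the derivative cancel.  With [U] invertible it gives the uniqueness of
    solutions without a Gronwall estimate. *)
Lemma solves_trmxC_mul_cst H U V x y :
  (forall t, H t \is hermsymmx) -> solves H U -> solves H V ->
  (U x)^t* *m V x = (U y)^t* *m V y.
Proof.
move=> hH HU HV; apply/matrixP => i j.
apply: (@cderiv0_cst R (fun x => ((U x)^t* *m V x) i j)) => t.
have := mxcderivM (mxcderiv_trmxC (HU t)) (HV t).
have -> : (- 'i *: (H t *m U t))^t* *m V t
    + (U t)^t* *m (- 'i *: (H t *m V t)) = 0 by exact: skew_product0 (hH t).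
by move/(_ i j); rewrite [in X in cderiv _ _ X -> _]mxE.
Qed.

Lemma evolution_unitary H U t :
  (forall t, H t \is hermsymmx) -> evolution H U -> U t \is unitarymx.
Proof.
move=> hH HU; have sU := evolution_solves HU; have [U0 _] := HU.
rewrite -trmxC_unitary; apply/unitarymxP; rewrite trmxCK.
by rewrite (solves_trmxC_mul_cst t 0 hH sU sU) U0 trmx1 map_mx1 mulmx1.
Qed.

Lemma evolution_flow H U V t : (forall t, H t \is hermsymmx) ->
  evolution H U -> solves H V -> V t = U t *m V 0.
Proof.
move=> hH HU sV; have sU := evolution_solves HU; have [U0 _] := HU.
have := solves_trmxC_mul_cst t 0 hH sU sV; rewrite U0 trmx1 map_mx1 mul1mx => <-.
by rewrite mulmxA (unitarymxP (evolution_unitary t hH HU)) mul1mx.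
Qed.

Lemma evolution_shift H U T t : (forall t, H t \is hermsymmx) ->
  periodic H T -> evolution H U -> U (t + T) = U t *m U T.
Proof.
move=> hH pH HU; rewrite -{2}[T]add0r.
apply: (evolution_flow (V := fun t => U (t + T)) t hH HU) => x i j.
rewrite -(pH x); apply: (@cderiv_shift R (fun x => U x i j)).
exact: (evolution_solves HU).
Qed.

(** Time reversal changes the sign of the derivative, and conjugation by [Gam]
    turns - H (- t) into H t: so [Gam *m U (- t) *m Gam] solves the same initial
    value problem as [U t]. *)
Lemma evolution_chiral H U (Gam : M) t : (forall t, H t \is hermsymmx) ->
  (forall t, Gam *m H t *m Gam = - H (- t)) -> Gam *m Gam = 1%:M ->
  evolution H U -> U (- t) = Gam *m U t *m Gam.
Proof.
move=> hH chi GG HU; have [U0 _] := HU.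
suff -> : U t = Gam *m U (- t) *m Gam.
  by rewrite !mulmxA GG mul1mx -mulmxA GG mulmx1.
rewrite (evolution_flow (V := fun t => Gam *m U (- t) *m Gam) t hH HU).
  by rewrite oppr0 U0 mulmx1 GG mulmx1.
move=> x.
have sN : mxcderiv (fun x => U (- x)) x ('i *: (H (- x) *m U (- x))).
  have sU : solves H U by exact: evolution_solves.
  have sx := sU (- x).
  move=> i j; have := cderiv_opp (sx i j).
  by rewrite !mxE mulNr opprK.
have := mxcderivM (mxcderivM (mxcderiv_cst Gam x) sN) (mxcderiv_cst Gam x).
rewrite mul0mx add0r mulmx0 addr0 (chiral_generator (B := H x)) //.
by rewrite chi opprK.
Qed.

(** By periodicity U (T / 2) = U (- T / 2) * U T, and the chiral symmetry
    expresses U (- T / 2) through U (T / 2), so half a period determines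
    [UT]. *)
Lemma floquet_factor H T UT (Gam : M) :
  (forall t, H t \is hermsymmx) -> periodic H T ->
  (forall t, Gam *m H t *m Gam = - H (- t)) ->
  Gam \is unitarymx -> Gam *m Gam = 1%:M -> is_floquet H T UT ->
  exists2 G, G \is unitarymx & UT = Gam *m G *m Gam *m G^t*.
Proof.
move=> hH pH chi uG GG [U HU <-].
exists ((U (T / 2))^t*); first by rewrite trmxC_unitary (evolution_unitary _ hH HU).
have E := evolution_shift (- (T / 2)) hH pH HU.
have uT := evolution_unitary (- (T / 2)) hH HU.
rewrite -[U T]mul1mx -(trmxC_mul_unitary uT) -mulmxA -E (evolution_chiral _ hH chi GG HU).
have -> : - (T / 2) + T = T / 2 by field.
by rewrite !trmxC_mul trmxCK (unitary_involution_trmxC uG GG) !mulmxA.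
Qed.

End Evolution.

(** * The exponential *)

Section Exponential.
Variable R : realType.
Local Notation C := (Cplx R).
Local Open Scope classical_set_scope.
Local Open Scope sesquilinear_scope.

(** This is exp (- i t). *)
Definition expNi (t : R) : C := real_complex R (cos t) - 'i * real_complex R (sin t).

Lemma exp_coeffNi (t : R) k : (k`!%:R)^-1 * (- 'i * real_complex R t) ^+ k =
  real_complex R (cos_coeff t k) - 'i * real_complex R (sin_coeff t k) :> C.
Proof.
rewrite /cos_coeff /sin_coeff /= !rmorphM !fmorphV !rmorphXn !rmorphN1 !rmorph_nat.
rewrite exprMn exprNi; ring.
Qed.

Lemma cvg_exp_series (t : R) :
  series (fun k => (k`!%:R)^-1 * (- 'i * real_complex R t : C) ^+ k) @ \oo
    --> expNi t.
Proof.
have ccos : series (cos_coeff t) x @[x --> \oo] --> cos t.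
  by rewrite unlock; exact: is_cvg_series_cos_coeff.
have csin : series (sin_coeff t) x @[x --> \oo] --> sin t.
  by rewrite unlock; exact: is_cvg_series_sin_coeff.
pose proof (K := cvgB (cvg_real_complex ccos)
  (cvgM (cvg_cst ('i : C)) (cvg_real_complex csin))).
apply: near_eq_cvg_to K _; near=> m.
rewrite /series /=.
rewrite -[X in _ + X]/(- ('i * real_complex R (\sum_(0 <= k < m) sin_coeff t k))).
rewrite !raddf_sum mulr_sumr -sumrB.
by apply: eq_bigr => k _; rewrite exp_coeffNi.
Unshelve. all: by end_near. Qed.

Lemma cvg_mx_coord (T : Type) (F : set_system T) {FF : Filter F} m n
    (f : T -> 'M[C]_(m, n)) (l : 'M[C]_(m, n)) :
  (forall i j, f x i j @[x --> F] --> l i j) -> f x @[x --> F] --> l.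
Proof.
move=> fl; apply/cvg_mx_entourageP => A entA.
apply: filter_forall => i; apply: filter_forall => j.
have /cvg_entourageP/(_ A entA) := fl i j.
rewrite !near_simpl => fA; apply: filterS fA => x fx.
exact/mem_set.
Qed.

Lemma expmx_unitary_diag n (Q : 'M[C]_n) (t : 'I_n -> R) : Q \is unitarymx ->
  expmx (- 'i *: (Q *m diag_mx (\row_j (real_complex R (t j) : C)) *m Q^t*))
  = Q *m diag_mx (\row_j expNi (t j)) *m Q^t*.
Proof.
move=> uQ; apply: cvg_lim; first exact: norm_hausdorff.
have -> : - 'i *: (Q *m diag_mx (\row_j (real_complex R (t j) : C)) *m Q^t*)
    = Q *m diag_mx (\row_j (- 'i * real_complex R (t j) : C)) *m Q^t*.
  rewrite scalemxAl scalemxAr -linearZ; congr (_ *m diag_mx _ *m _).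
  by apply/rowP => j; rewrite !mxE.
under eq_cvg do rewrite /series /= sum_expr_unitary_diag //.
apply: cvg_mx_coord => i j.
have E (d : 'rV[C]_n) : (Q *m diag_mx d *m Q^t*) i j
    = \sum_k Q i k * d 0 k * (Q j k)^*.
  by rewrite mxE; apply: eq_bigr => k _; rewrite mul_mx_diag !mxE.
rewrite E; under eq_cvg do rewrite E.
apply: cvg_sum => k.
apply: cvgM; last exact: cvg_cst.
apply: cvgM; first exact: cvg_cst.
rewrite mxE; under eq_cvg do rewrite mxE.
pose proof (K := @cvg_exp_series (t k)).
apply: near_eq_cvg_to K _; near=> m.
by apply: eq_bigr => l _; rewrite mxE.
Unshelve. all: by end_near. Qed.

Lemma expNiE t : expNi t = Complex (cos t) (- sin t).
Proof.
rewrite /expNi -complexiE; apply/eqP; rewrite eq_complex /=.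
by rewrite !(mul0r, mulr0, mul1r, subr0, add0r, addr0, oppr0, sub0r) !eqxx.
Qed.

Lemma conj_expNi t : (expNi t)^* = expNi (- t).
Proof. by rewrite !expNiE cosN sinN. Qed.

(** The arccosine of the real part is an argument of [l] up to sign, and the
    sign of the imaginary part decides which one it is. *)
Lemma expNi_surj (l : C) : `|l| = 1 -> exists t, expNi t = l.
Proof.
case: l => a b; rewrite normc_def => /complexI ab1.
have {}ab1 : a ^+ 2 + b ^+ 2 = 1.
  by rewrite -[LHS]sqr_sqrtr ?addr_ge0 ?sqr_ge0 // ab1 expr1n.
have aI : -1 <= a <= 1.
  by rewrite -ler_norml -sqrtr_sqr -sqrtr1 ler_wsqrtr // -ab1 lerDl sqr_ge0.
have sa : sin (acos a) = `|b|.
  by rewrite sin_acos // -ab1 addrC addKr sqrtr_sqr.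
have ca : cos (acos a) = a by rewrite acosK // in_itv.
case: (leP 0 b) => [b0|b0].
  exists (- acos a); rewrite expNiE cosN sinN ca sa opprK ger0_norm //.
by exists (acos a); rewrite expNiE ca sa ltr0_norm // opprK.
Qed.

End Exponential.

(** * Chiral Floquet operators *)

Theorem theorem3p9 (R : realType) (N : nat) (T : R)
    (H : R -> 'M[Cplx R]_N) (Gamma UT : 'M[Cplx R]_N)
    (N_gt0 : (0 < N)%N) (N_even : ~~ odd N) (T_gt0 : 0 < T)
    (H_cont : continuous H) (H_per : periodic H T)
    (H_herm : forall t, H t \is hermsymmx)
    (Gamma_unitary : Gamma \is unitarymx)
    (Gamma_sqr : Gamma *m Gamma = 1%:M)
    (Gamma_eigN1 : dim_eigenspace Gamma (-1) = N./2)
    (Gamma_eig1 : dim_eigenspace Gamma 1 = N./2)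
    (chiral : forall t, Gamma *m H t *m Gamma = - H (- t))
    (UT_floquet : is_floquet H T UT) :
  (exists Heff : 'M[Cplx R]_N,
     [/\ Heff \is hermsymmx,
         Gamma *m Heff = - (Heff *m Gamma)
       & expmx (- 'i *: Heff) = UT]) /\
  (exists (b : 'I_N -> 'cV[Cplx R]_N) (lambda : 'I_N -> Cplx R),
     [/\ orthonormal_basis b,
         (forall j, `|lambda j| = 1),
         (forall j, UT *m b j = lambda j *: b j)
       & forall j k : 'I_N, (j < N./2)%N -> k = (N./2 + j)%N :> nat ->
           Gamma *m b j = b k /\ (lambda j)^* = lambda k]).
Proof.
have [n NE] : exists n, N = (n + n)%N.
  by exists N./2; rewrite addnn even_halfK.
subst N; have n2 : (n + n)./2 = n by rewrite addnn doubleK.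
rewrite n2 in Gamma_eigN1 Gamma_eig1 *.
have [G uG UTE] :=
  floquet_factor H_herm H_per chiral Gamma_unitary Gamma_sqr UT_floquet.
have [L [l [uQ l1]]] :=
  eigenframe Gamma_unitary Gamma_sqr Gamma_eig1 Gamma_eigN1 uG.
rewrite -UTE => UQ; split; last first.
  have [Ub Gb] := eigenframe_columns UQ.
  exists (fun j => col j (row_mx L (Gamma *m L))).
  exists (fun j => row_mx l (map_mx Num.conj l) 0 j); split=> //.
    exact: unitary_orthonormal_basis.
  exact: eigenframe_modulus.
have /choice[t tE] : forall j, exists t : R, expNi t = l 0 j.
  by move=> j; exact: expNi_surj.
pose r : 'rV[Cplx R]_n := \row_j real_complex R (t j).
have rR j : r 0 j \is Num.real by rewrite mxE; apply/complex_realP; exists (t j).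
have [hA GA] := paired_generator L
  (unitary_involution_trmxC Gamma_unitary Gamma_sqr) Gamma_sqr rR.
eexists; split; [exact: hA | exact: GA |].
(* exp (- i s_j) = lambda_j, also on Gamma L, where conjugation negates s. *)
pose s j := match fintype.split j with inl i => t i | inr i => - t i end.
have -> : row_mx r (- r) = \row_j (real_complex R (s j) : Cplx R).
  apply/rowP => j; rewrite !mxE /s.
  by case: fintype.split => i; rewrite !mxE // rmorphN.
rewrite expmx_unitary_diag // -[RHS](mulmxtVK _ uQ) UQ.
congr (_ *m diag_mx _ *m _).
apply/rowP => j; rewrite !mxE /s.
by case: fintype.split => i; rewrite ?mxE -?conj_expNi tE.
Qed.
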